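(* For $0\le s\le 2$ and every integer $n\ge 0$, $$R_1(s,3,3n+2)=\frac{\overline{pp}(3n+2)}{3}.$$
   Context: An overpartition of $n$ is a partition of $n$ in which the first occurrence of each number may be overlined; there is exactly one overpartition of $0$ (the empty one). An overpartition pair of $n$ is an ordered pair $\pi=(\lambda,\mu)$ of overpartitions such that the sum of all parts of $\lambda$ and $\mu$ is $n$ (either may be the overpartition of $0$). $\overline{pp}(n)$ denotes the number of overpartition pairs of $n$. For an overpartition $\lambda$, $n_1(\lambda)$ denotes the number of parts of $\lambda$ (overlined and non-overlined, counted with multiplicity). For an overpartition pair $\pi=(\lambda,\mu)$, define $r_1(\pi)=n_1(\lambda)-n_1(\mu)$ (so the empty pair of $0$ has $r_1=0$). $R_1(s,t,n)$ is the number of overpartition pairs $\pi$ of $n$ with $r_1(\pi)\equiv s\pmod t$. *)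

(* Defs.v *)
From mathcomp Require Import all_boot all_order all_algebra.
Set Implicit Arguments.
Unset Strict Implicit.
Unset Printing Implicit Defensive.

Import Order.TTheory GRing.Theory Num.Theory.

(* A candidate overpartition lists its parts as pairs (size, overlined?). *)
Definition ovseq : Type := seq (nat * bool).

Definition parts (l : ovseq) : seq nat := unzip1 l.

(* index x s is the position of the first occurrence of x in s, so the last
   conjunct says that only first occurrences carry an overline. *)
Definition is_overpartition (l : ovseq) : bool :=
  [&& all (fun k => 0 < k) (parts l),
      sorted geq (parts l)
    & all (fun i => nth false (unzip2 l) i ==>
                    (index (nth 0 (parts l) i) (parts l) == i))
          (iota 0 (size l))].

Definition n1 (l : ovseq) : nat := size l.

Definition is_overpartition_pair (n : nat) (p : ovseq * ovseq) : bool :=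
  [&& is_overpartition p.1, is_overpartition p.2
    & sumn (parts p.1) + sumn (parts p.2) == n].

Definition r1 (p : ovseq * ovseq) : int := ((n1 p.1)%:Z - (n1 p.2)%:Z)%R.

(* In an overpartition pair of n, each component has at most n parts, and each
   part is at most n. Hence all these pairs live in the finite type
   ovbox n * ovbox n; see unbox_pair_inj and unbox_pair_onto. *)
Definition ovbox (n : nat) : finType := n.-bseq ('I_n.+1 * bool)%type.

Definition unbox (n : nat) (b : ovbox n) : ovseq :=
  [seq (val x.1, x.2) | x <- bseqval b].

Definition unbox_pair (n : nat) (b : ovbox n * ovbox n) : ovseq * ovseq :=
  (unbox b.1, unbox b.2).

Definition overpartition_pairs (n : nat) : {set ovbox n * ovbox n} :=
  [set b | is_overpartition_pair n (unbox_pair b)].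

Definition pp (n : nat) : nat := #|overpartition_pairs n|.

Definition R1 (s t : int) (n : nat) : nat :=
  #|[set b in overpartition_pairs n | (r1 (unbox_pair b) == s %[mod t])%Z]|.

Lemma unbox_inj n : injective (@unbox n).
Proof.
move=> a b eq_ab; apply/val_inj; apply: inj_map eq_ab => -[i x] [j y] [ij ->].
by congr pair; apply: val_inj.
Qed.

Lemma unbox_pair_inj n : injective (@unbox_pair n).
Proof. by move=> [a b] [c d] [/unbox_inj -> /unbox_inj ->]. Qed.

Lemma unbox_onto n (l : ovseq) :
  is_overpartition l -> sumn (parts l) <= n -> exists b : ovbox n, unbox b = l.
Proof.
case/and3P=> pos _ _ le_n.
have le_part k : k \in parts l -> k <= n.
  move=> kl; apply: leq_trans le_n; elim: (parts l) kl => //= a s IH.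
  rewrite inE => /orP[/eqP->|/IH]; first exact: leq_addr.
  by move/leq_trans; apply; exact: leq_addl.
have size_l : size l <= n.
  apply: leq_trans le_n; have <- : size (parts l) = size l by exact: size_map.
  elim: (parts l) pos => //= a s IH /andP[a0 /IH le_s].
  by rewrite -add1n leq_add.
pose c : seq ('I_n.+1 * bool) := [seq (inord x.1, x.2) | x <- l].
have size_c : size c <= n by rewrite size_map.
exists (Bseq size_c); rewrite /unbox /= /c -map_comp.
rewrite -[RHS]map_id; apply/eq_in_map => -[k o] kl /=.
by rewrite inordK // ltnS; apply: le_part; apply/mapP; exists (k, o).
Qed.

Lemma unbox_pair_onto n (p : ovseq * ovseq) :
  is_overpartition_pair n p ->
  exists2 b, b \in overpartition_pairs n & unbox_pair b = p.
Proof.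
case: p => l m op; case/and3P: (op) => /= ol om /eqP eq_n.
have [|a al] := @unbox_onto n l ol; first by rewrite -eq_n leq_addr.
have [|b bm] := @unbox_onto n m om; first by rewrite -eq_n leq_addl.
by exists (a, b); rewrite ?inE /unbox_pair /= al bm.
Qed.

(* Main.v *)
Require Import Defs.
From mathcomp Require Import all_boot all_order all_algebra.
From mathcomp Require Import all_field.
From mathcomp Require Import ring zify.

(** Counting overpartitions with weight z^(number of parts) gives
    prod_k (1 + z q^k) / (1 - z q^k), so weighting a pair by z^r_1 gives
<<
    prod_k (1 + z q^k)(1 + q^k/z) / ((1 - z q^k)(1 - q^k/z)).
>>
    At a primitive cube root of unity z = w, the factorization
    (1 + wy)(1 + w^2 y)(1 + y) = 1 + y^3 and the same with -y turn this into
<<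
    prod_k (1 + q^(3k)) / (1 - q^(3k))  *  prod_k (1 - q^k) / (1 + q^k).
>>
    The first product is a power series in q^3, and by Gauss the second one is
    the sum of (-1)^j q^(j^2) over all integers j. No square is 2 modulo 3, so
    the coefficient at q^(3n+2) vanishes ([coef_pair_eq0]). But this
    coefficient is R_1(0) + R_1(1) w + R_1(2) w^2, and every linear
    relation with integer coefficients between 1, w, w^2 is a multiple of
    1 + w + w^2 = 0 ([cube_root_free]); so the three numbers are equal, and each is a third of
    their total, the number of overpartition pairs.

    Power series are replaced by polynomials compared up to degree N = 3n+2
    ([eqx]), and denominators are cleared. Overpartitions are generated by
    their largest part ([ovlist_bounded], [ovlist_plain_bounded],
    [ovgf_prod]), and Gauss's identity comes from a finite identity with an
    explicit error term, proved by induction ([shanks_gauss]). *)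

Set Implicit Arguments.
Unset Strict Implicit.
Unset Printing Implicit Defensive.

Import Order.TTheory GRing.Theory Num.Theory.

(** * Enumerating overpartitions by their largest part *)

(** The relation between consecutive parts of an overpartition: since equal
    parts are adjacent in a nonincreasing list, a part is a first occurrence
    exactly when it is strictly smaller than its predecessor. *)
Definition ovrel (x y : nat * bool) : bool :=
  (y.1 < x.1) || (y.1 == x.1) && ~~ y.2.

Lemma ovrel_trans : transitive ovrel.
Proof. by move=> [b o] [a o'] [c o'']; rewrite /ovrel /=; lia. Qed.

(** Being an overpartition is a local condition on consecutive parts, which,
    unlike the condition on positions of first occurrences, passes to tails
    and so allows recursion on the list. *)
Lemma is_overpartition_sorted l :
  is_overpartition l = all (fun k => 0 < k) (parts l) && sorted ovrel l.
Proof.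
rewrite /is_overpartition; congr (_ && _).
elim: l => //= x t IH.
rewrite (path_sortedE ovrel_trans) -IH.
rewrite (path_sortedE (fun y x z xy yz => leq_trans yz xy)) eqxx implybT /=.
rewrite -[1]addn0 iotaDl all_map.
have -> : all (preim (addn 1) (fun i => nth false (x.2 :: unzip2 t) i ==>
             (index (nth 0 (x.1 :: parts t) i) (x.1 :: parts t) == i)))
            (iota 0 (size t)) =
          all (fun y => y.2 ==> (x.1 != y.1)) t &&
          all (fun i => nth false (unzip2 t) i ==>
             (index (nth 0 (parts t) i) (parts t) == i)) (iota 0 (size t)).
  have -> : all (fun y => y.2 ==> (x.1 != y.1)) t =
     all (fun i => nth false (unzip2 t) i ==> (x.1 != nth 0 (parts t) i))
       (iota 0 (size t)).
    rewrite -[in LHS](mkseq_nth (0, false) t) all_map.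
    apply: eq_in_all => i; rewrite mem_iota /= => lti.
    by rewrite !(nth_map (0, false)).
  rewrite -all_predI; apply: eq_all => i /=.
  by rewrite add1n /=; case: (x.1 == _); case: nth; rewrite //= eqSS.
set Q := all (fun i => _ ==> _) _.
have -> : all (ovrel x) t =
    all (geq x.1) (parts t) && all (fun y => y.2 ==> (x.1 != y.1)) t.
  rewrite /parts all_map -all_predI.
  by apply: eq_all => y /=; rewrite /ovrel; lia.
by rewrite -!andbA; congr (_ && _); rewrite andbCA.
Qed.

(** Filtering the images of the finite type [ovbox m] yields a duplicate-free
    list of bare sequences; overpartitions of different sizes m then live in
    one type and can be compared. *)
Definition ovlist (P : pred ovseq) (m : nat) : seq ovseq :=
  [seq l <- [seq unbox b | b : ovbox m]
     | [&& is_overpartition l, P l & sumn (parts l) == m]].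

Lemma mem_ovlist P m l :
  (l \in ovlist P m) = [&& is_overpartition l, P l & sumn (parts l) == m].
Proof.
rewrite mem_filter; case: and3P => //= -[ol _ /eqP suml].
have [|b <-] := @unbox_onto m l ol; first by rewrite suml.
by apply/mapP; exists b; rewrite ?mem_enum.
Qed.

Lemma ovlist_uniq P m : uniq (ovlist P m).
Proof.
by rewrite filter_uniq // map_inj_uniq ?enum_uniq //; exact: unbox_inj.
Qed.

(** Splitting on whether the first part is [x]: removing [x] is a bijection
    from the overpartitions in [P] that begin with [x] onto those in [T]. *)
Lemma ovlist_split (P Q T : pred ovseq) (x : nat * bool) (m : nat) :
  (forall l, [&& is_overpartition l, P l & ohead l != Some x]
             = is_overpartition l && Q l) ->
  (forall t, is_overpartition (x :: t) && P (x :: t)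
             = is_overpartition t && T t) ->
  perm_eq (ovlist P m)
    (ovlist Q m ++
     if x.1 <= m then [seq x :: t | t <- ovlist T (m - x.1)] else [::]).
Proof.
move=> PQ PT.
have QN t : is_overpartition (x :: t) && Q (x :: t) = false.
  by rewrite -PQ /= eqxx !andbF.
apply: uniq_perm; first exact: ovlist_uniq.
  rewrite cat_uniq ovlist_uniq /=; apply/andP; split; last first.
    by case: ifP => // _; rewrite map_inj_uniq ?ovlist_uniq // => a b [].
  case: ifP => // _; rewrite -all_predC; apply/allP => _ /mapP[t _ ->] /=.
  by rewrite mem_ovlist andbA QN.
move=> l; rewrite mem_cat !mem_ovlist.
have -> : (l \in (if x.1 <= m then [seq x :: t | t <- ovlist T (m - x.1)]
                  else [::])) =
    [&& is_overpartition l, P l, sumn (parts l) == m & ohead l == Some x].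
  apply/idP/idP.
    case: ifP => // lexm /mapP[t]; rewrite mem_ovlist andbA -PT.
    move=> /andP[/andP[ol Pl] /eqP suml] ->.
    by rewrite ol Pl /= suml subnKC ?eqxx.
  case: l => [|y t]; rewrite /= ?andbF // => /and4P[ol Pl /eqP suml /eqP[eqyx]].
  move: ol Pl suml; rewrite eqyx => ol Pl <-; rewrite leq_addr addKn map_f //.
  by rewrite mem_ovlist andbA -PT ol Pl eqxx.
rewrite [in RHS]andbA -PQ; case: is_overpartition; case: (P l) => //=.
by case: (_ == m); case: (_ == Some x).
Qed.

Definition bounded (k : nat) (l : ovseq) : bool := head 0 (parts l) <= k.

(** Among overpartitions, these are the ones with parts at most [k] and [k] not
    overlined: a fictitious overlined [k] may be put in front of the list. *)
Definition plain_bounded (k : nat) (l : ovseq) : bool := path ovrel (k, true) l.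

Lemma ovlist_bounded k m :
  perm_eq (ovlist (bounded k.+1) m)
    (ovlist (plain_bounded k.+1) m ++
     if k.+1 <= m
     then [seq (k.+1, true) :: t | t <- ovlist (plain_bounded k.+1) (m - k.+1)]
     else [::]).
Proof.
apply: (@ovlist_split _ _ _ (k.+1, true)) => [[|[j o] t]|t] //.
  rewrite !is_overpartition_sorted; case: (all _ (parts _)) => //.
  rewrite /bounded /plain_bounded /= ?andTb.
  rewrite -[Some _ == _]/((j, o) == (k.+1, true)) xpair_eqE.
  by case: (path ovrel (j, o) t); rewrite ?andbF // /ovrel /=; case: o; lia.
rewrite !is_overpartition_sorted /bounded /plain_bounded /= leqnn andbT.
case: (all _ (parts t)) => //=.
by apply/idP/andP => [tP|[]//]; rewrite (path_sorted tP).
Qed.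

Lemma ovlist_plain_bounded k m :
  perm_eq (ovlist (plain_bounded k.+1) m)
    (ovlist (bounded k) m ++
     if k.+1 <= m
     then [seq (k.+1, false) :: t | t <- ovlist (plain_bounded k.+1) (m - k.+1)]
     else [::]).
Proof.
apply: (@ovlist_split _ _ _ (k.+1, false)) => [[|[j o] t]|t] //.
  rewrite !is_overpartition_sorted; case: (all _ (parts _)) => //.
  rewrite /bounded /plain_bounded /= ?andTb.
  rewrite -[Some _ == _]/((j, o) == (k.+1, false)) xpair_eqE.
  by case: (path ovrel (j, o) t); rewrite ?andbF // /ovrel /=; case: o; lia.
rewrite !is_overpartition_sorted /bounded /plain_bounded /=.
case: (all _ (parts t)) => //=.
rewrite {2}/ovrel /= eqxx orbT /=.
have -> : path ovrel (k.+1, false) t = path ovrel (k.+1, true) t by case: t.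
by rewrite andbb; apply/idP/andP => [tP|[]//]; rewrite (path_sorted tP).
Qed.

Lemma ovlist_bounded0 m :
  perm_eq (ovlist (bounded 0) m) (if m == 0 then [:: [::]] else [::]).
Proof.
apply: uniq_perm; rewrite ?ovlist_uniq //; first by case: eqP.
move=> l; rewrite mem_ovlist is_overpartition_sorted /bounded.
case: l => [|x t] /=; first by case: m.
by case: x => [[|k] o]; rewrite ?andbF; case: m => [|m].
Qed.

Lemma bounded_overpartition k l :
  is_overpartition l -> sumn (parts l) <= k -> bounded k l.
Proof. by case: l => //= x t _; rewrite /bounded /=; lia. Qed.

(** * Truncated generating functions *)

Section GeneratingFunction.

Local Open Scope ring_scope.

Variables (R : comNzRingType) (N : nat).

(** Equality of power series modulo X^(N+1), on polynomial representatives. *)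
Definition eqx (p q : {poly R}) : Prop := forall i, (i <= N)%N -> p`_i = q`_i.

Lemma eqx_refl p : eqx p p. Proof. by []. Qed.

Lemma eqx_eq p q : p = q -> eqx p q. Proof. by move->. Qed.

Lemma eqx_sym p q : eqx p q -> eqx q p.
Proof. by move=> pq i iN; rewrite pq. Qed.

Lemma eqx_trans q p r : eqx p q -> eqx q r -> eqx p r.
Proof. by move=> pq qr i iN; rewrite pq ?qr. Qed.

Lemma eqxM p p' q q' : eqx p p' -> eqx q q' -> eqx (p * q) (p' * q').
Proof.
move=> pp qq i iN; rewrite !coefM; apply: eq_bigr => j _.
by rewrite pp ?qq //; have := ltn_ord j; lia.
Qed.

Definition weight (z : R) (P : pred ovseq) (m : nat) : R :=
  \sum_(l <- ovlist P m) z ^+ size l.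

Definition ovgf (z : R) (P : pred ovseq) : {poly R} :=
  \poly_(m < N.+1) weight z P m.

Lemma ovgf_split z P Q T (x : nat * bool) :
  (forall m, perm_eq (ovlist P m)
    (ovlist Q m ++
     if (x.1 <= m)%N then [seq x :: t | t <- ovlist T (m - x.1)] else [::])) ->
  eqx (ovgf z P) (ovgf z Q + z%:P * 'X^(x.1) * ovgf z T).
Proof.
move=> PQT i iN; rewrite coefD -mulrA coefCM coefXnM !coef_poly !ltnS iN.
rewrite (leq_trans (leq_subr _ _) iN) /weight (perm_big _ (PQT i)) big_cat /=.
congr (_ + _); rewrite ltnNge; case: leqP => _; last by rewrite big_nil mulr0.
by rewrite big_map mulr_sumr; apply: eq_bigr => l _; rewrite exprS.
Qed.

(** The factor (1 + zX^k) / (1 - zX^k) contributed by the part size k arises in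
    two steps: at most one overlined k gives 1 + zX^k, and any number of
    plain copies of k gives 1 / (1 - zX^k). *)
Lemma ovgf_prod z k :
  eqx (\prod_(j < k) (1 - z%:P * 'X^(j.+1)) * ovgf z (bounded k))
      (\prod_(j < k) (1 + z%:P * 'X^(j.+1))).
Proof.
elim: k => [|k IH].
  rewrite !big_ord0 mul1r => i iN; rewrite coef_poly ltnS iN /weight.
  rewrite (perm_big _ (ovlist_bounded0 i)) coef1.
  by case: i {iN} => [|i]; rewrite ?big_seq1 ?big_nil.
rewrite !big_ord_recr /=.
set A := ovgf z (bounded k.+1); set B := ovgf z (plain_bounded k.+1).
set C := ovgf z (bounded k) in IH; set y := z%:P * _.
set p := \prod_(j < k) _ in IH *; set q := \prod_(j < k) _ in IH *.
have AB : eqx A ((1 + y) * B).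
  rewrite mulrDl mul1r.
  exact: (@ovgf_split _ _ _ _ (k.+1, true)) (ovlist_bounded k).
have BC : eqx ((1 - y) * B) C.
  have := @ovgf_split z _ _ _ (k.+1, false) (ovlist_plain_bounded k).
  by move=> BC i /BC; rewrite mulrBl mul1r coefB coefD => ->; rewrite addrK.
apply: (eqx_trans (eqxM (eqx_refl _) AB)).
have -> : p * (1 - y) * ((1 + y) * B) = (p * (1 + y)) * ((1 - y) * B) by ring.
apply: (eqx_trans (eqxM (eqx_refl _) BC)).
by rewrite mulrAC; apply: eqxM.
Qed.

Definition missing (d r : nat) (p : {poly R}) : Prop :=
  forall i, (i <= N)%N -> (i = r %[mod d])%N -> p`_i = 0.

Definition in_powers (d : nat) (p : {poly R}) : Prop :=
  forall i, ~~ (d %| i)%N -> p`_i = 0.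

Lemma missingM d r p q : in_powers d p -> missing d r q -> missing d r (p * q).
Proof.
move=> dp rq i iN ir; rewrite coefM big1 // => j _.
have [dj|/dp->] := boolP (d %| j)%N; last by rewrite mul0r.
rewrite rq ?mulr0 ?(leq_trans (leq_subr _ _)) // -ir.
have ji : (j <= i)%N by rewrite -ltnS.
by rewrite -[in RHS](subnKC ji) -modnDml (eqP dj) add0n.
Qed.

Lemma in_powersM d p q : in_powers d p -> in_powers d q -> in_powers d (p * q).
Proof.
move=> dp dq i di; rewrite coefM big1 // => j _.
have [dj|/dp->] := boolP (d %| j)%N; last by rewrite mul0r.
rewrite dq ?mulr0 //; apply: contra di => dij.
by rewrite -(@subnKC j i) ?dvdn_addr // -ltnS.
Qed.

Lemma in_powers_prod d k (F : 'I_k -> {poly R}) :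
  (forall j, in_powers d (F j)) -> in_powers d (\prod_j F j).
Proof.
move=> dF; apply: big_ind => // [i|]; last exact: in_powersM.
by rewrite coef1; case: i => [|i]; rewrite ?dvdn0.
Qed.

(** Multiplying by a power series in X^d with constant term 1 mixes only
    exponents in the same class modulo d, and is invertible on each class. *)
Lemma missing_cancel d r (u p : {poly R}) :
  in_powers d u -> u`_0 = 1 -> missing d r (u * p) -> missing d r p.
Proof.
move=> du u0 rup i; elim/ltn_ind: i => i IH iN ir.
have := rup i iN ir; rewrite coefM big_ord_recl u0 mul1r subn0 big1 ?addr0 //.
move=> j _; rewrite lift0.
have [dj|/du->] := boolP (d %| j.+1)%N; last by rewrite mul0r.
rewrite IH ?mulr0 //; have := ltn_ord j; try lia.
move=> ji; rewrite -ir.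
by rewrite -[in RHS](subnKC ji) -modnDml (eqP dj) add0n.
Qed.

Lemma eqx_cancel (u p q : {poly R}) :
  u`_0 = 1 -> eqx (u * p) (u * q) -> eqx p q.
Proof.
move=> u0 upq i iN; apply/eqP; rewrite -subr_eq0 -coefB; apply/eqP.
apply: (@missing_cancel 1 0 u) => [j||j jN _||]; rewrite ?dvd1n ?modn1 ?u0 ?iN//.
by rewrite mulrBr coefB upq ?subrr.
Qed.

End GeneratingFunction.

(** * Gauss's identity for the squares *)

Section Gauss.

Local Open Scope ring_scope.

Variables (R : comNzRingType) (q : R).

(** A finite form, in the manner of Shanks, of Gauss's identity
    prod (1 - q^k) / (1 + q^k) = sum over all integers j of (-1)^j q^(j^2).
    The error is an explicit sum divisible by q^(n+1), and each increment in n
    telescopes, so that induction on n is enough. *)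
Lemma shanks_gauss n :
  \prod_(1 <= k < n.+1) (1 + q ^+ k)
    * (1 + 2 * \sum_(1 <= j < n.+1) (-1) ^+ j * q ^+ (j ^ 2))
  = \prod_(1 <= k < n.+1) (1 - q ^+ k)
    + 2 * \sum_(1 <= s < n.+1) (-1) ^+ s * (q ^+ (s * n.+1)
          * \prod_(s.+1 <= k < n.+1) (1 - q ^+ k)
          * \prod_(1 <= k < s) (1 + q ^+ k)).
Proof.
(* t s is the s-th error term for n, and u s is what telescopes over s when
   the error terms for n and n + 1 are compared. *)
elim: n => [|n IH]; first by rewrite !big_geq // !mulr0 !addr0 mulr1.
pose u s := q ^+ (s * n.+1) * \prod_(s <= k < n.+1) (1 - q ^+ k)
              * \prod_(1 <= k < s) (1 + q ^+ k).
pose t s := q ^+ (s * n.+1) * \prod_(s.+1 <= k < n.+1) (1 - q ^+ k)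
              * \prod_(1 <= k < s) (1 + q ^+ k).
have step s : (1 <= s < n.+1)%N ->
    (-1) ^+ s * (q ^+ (s * n.+2)
          * \prod_(s.+1 <= k < n.+2) (1 - q ^+ k)
          * \prod_(1 <= k < s) (1 + q ^+ k))
    = (1 + q ^+ n.+1) * ((-1) ^+ s * t s)
      + ((-1) ^+ s.+1 * u s.+1 - (-1) ^+ s * u s).
  case/andP=> s1 sn; rewrite big_nat_recr //= /u /t.
  rewrite (big_ltn sn) (@big_nat_recr _ _ _ s 1) //= [(s * n.+2)%N]mulnS.
  rewrite [(s.+1 * n.+1)%N]mulSn !exprD !exprS.
  move: (\prod_(_ <= _ < _) _) (\prod_(_ <= _ < _) _) => a b.
  ring.
rewrite [X in X * _]big_nat_recr // [\sum_(1 <= j < n.+2) _]big_nat_recr //=.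
rewrite [\prod_(1 <= k < n.+2) (1 - _)]big_nat_recr //=.
rewrite [X in _ = _ + 2 * X]big_nat_recr //= (@big_geq _ _ _ n.+2) // mulr1.
rewrite (eq_big_nat _ _ step) big_split /= -mulr_sumr telescope_sumr //.
have -> : u 1%N = q ^+ n.+1 * \prod_(1 <= k < n.+1) (1 - q ^+ k).
  by rewrite /u mul1n [X in _ * X]big_geq // mulr1.
have -> : u n.+1 = q ^+ (n.+1 ^ 2) * \prod_(1 <= k < n.+1) (1 + q ^+ k).
  by rewrite /u [X in _ * X * _]big_geq // mulr1.
have -> : q ^+ (n.+1 * n.+2) = q ^+ (n.+1 ^ 2) * q ^+ n.+1.
  by rewrite -exprD mulnS addnC.
move: IH; rewrite -/t.
move: (q ^+ n.+1) (q ^+ (n.+1 ^ 2)) => x y.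
move: (\sum_(_ <= _ < _) _) (\sum_(_ <= _ < _) _) => T S.
move: (\prod_(_ <= _ < _) _) (\prod_(_ <= _ < _) _) => U D IH.
have -> : D * (1 + x) * (1 + 2 * (S + (-1) ^+ n.+1 * y)) =
   (1 + x) * (D * (1 + 2 * S)) + 2 * (-1) ^+ n.+1 * y * D * (1 + x) by ring.
rewrite IH; ring.
Qed.

End Gauss.

Section GaussPolynomial.

Local Open Scope ring_scope.

Lemma gauss_eqx (R : comNzRingType) N :
  eqx N (\prod_(j < N) (1 + 'X^(j.+1))
          * (1 + 2 * \sum_(1 <= j < N.+1) (-1) ^+ j * 'X^(j ^ 2)))
        (\prod_(j < N) (1 - 'X^(j.+1)) : {poly R}).
Proof.
have := shanks_gauss ('X : {poly R}) N.
rewrite !(big_add1 _ _ 0) /= !big_mkord => -> i iN.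
rewrite coefD -[2]/(2%:R) mulr_natl coefMn coef_sum.
rewrite [X in _ + X *+ 2]big1 ?mul0rn ?addr0 // => s _.
rewrite -!mulrA mulrCA coefXnM ifT //.
by rewrite mulSn; lia.
Qed.

(** A square is 0 or 1 modulo 3. *)
Lemma missing_squares (R : comNzRingType) N n :
  missing N 3 2 (1 + 2 * \sum_(1 <= j < n) (-1) ^+ j * 'X^(j ^ 2) : {poly R}).
Proof.
move=> i _ i2; rewrite coefD coef1 -[2]/(2%:R) mulr_natl coefMn coef_sum.
have -> : (i == 0)%N = false by case: i i2.
rewrite add0r big1 ?mul0rn // => j _.
have -> : (-1) ^+ j = ((-1) ^+ j)%:P :> {poly R} by rewrite rmorph_sign.
rewrite coefCM coefXn; case: eqP => [ij|]; last by rewrite mulr0.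
move: i2; rewrite ij -modnXm.
by have := ltn_pmod j (isT : (0 < 3)%N); case: (j %% 3)%N => [|[|[|]]].
Qed.

End GaussPolynomial.

(** * Sums over overpartition pairs *)

Section PairSums.

Local Open Scope ring_scope.

Lemma sum_pairs_coefM (R : comNzRingType) (z z' : R) N :
  \sum_(b in overpartition_pairs N)
     z ^+ n1 (unbox b.1) * z' ^+ n1 (unbox b.2)
  = (ovgf N z (bounded N) * ovgf N z' (bounded N))`_N.
Proof.
pose total (b : ovbox N * ovbox N) : 'I_N.+1 := inord (sumn (parts (unbox b.1))).
rewrite (partition_big total predT) //= coefM; apply: eq_bigr => i _.
rewrite !coef_poly !ltnS leq_subr -ltnS ltn_ord /weight big_distrlr /=.
pose F (p : ovseq * ovseq) := z ^+ n1 p.1 * z' ^+ n1 p.2.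
rewrite -[RHS](@big_allpairs _ _ _ _ _ _ _ F).
pose T := [set b in overpartition_pairs N | total b == i].
rewrite (eq_bigl (mem T)); last by move=> b; rewrite !inE.
rewrite -big_enum -[LHS](big_map (@unbox_pair N) predT F); apply: perm_big.
apply: uniq_perm.
- by rewrite map_inj_uniq ?enum_uniq //; exact: unbox_pair_inj.
- by apply: allpairs_uniq; rewrite ?ovlist_uniq // => -[? ?] [? ?].
move=> p; apply/mapP/allpairsP.
  case=> b; rewrite mem_enum !inE => /andP[/and3P[/= o1 o2 /eqP sumN] /eqP bi] ->.
  exists (unbox b.1, unbox b.2); rewrite !mem_ovlist /= o1 o2.
  have s1 : sumn (parts (unbox b.1)) = i.
    by rewrite -bi /total inordK // ltnS -[leqRHS]sumN leq_addr.
  have iN : (i <= N)%N by rewrite -ltnS.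
  have s2 : sumn (parts (unbox b.2)) = (N - i)%N.
    by rewrite -[X in (X - _)%N]sumN s1 addKn.
  by rewrite !bounded_overpartition ?s1 ?s2 ?eqxx ?leq_subr.
case=> -[l m]; rewrite !mem_ovlist /= => -[].
case/and3P=> ol _ /eqP sl /and3P[om _ /eqP sm] ->.
have iN : (i <= N)%N by rewrite -ltnS.
have [b bN bE] : exists2 b, b \in overpartition_pairs N & unbox_pair b = (l, m).
  by apply: unbox_pair_onto; rewrite /is_overpartition_pair ol om sl sm subnKC /=.
exists b => //; rewrite mem_enum inE bN /=; apply/eqP/val_inj.
by move: bE => [bl _]; rewrite /total bl sl inord_val.
Qed.

(** Exponents a - b of a cube root of unity are represented by the natural
    number a + 2b, so that no negative power has to be taken. *)
Lemma eq_mod3_subn (a b s : nat) : (s < 3)%N ->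
  (a%:Z - b%:Z == s%:Z %[mod 3%:Z])%Z = ((a + 2 * b) %% 3 == s)%N.
Proof.
move=> s3; have -> : a%:Z - b%:Z = - b%:Z * 3%:Z + (a + 2 * b)%N%:Z by lia.
by rewrite modzMDl !modz_nat eqz_nat (modn_small s3).
Qed.

Lemma sum_pairs_R1 (V : nmodType) (F : nat -> V) N :
  \sum_(b in overpartition_pairs N)
     F ((n1 (unbox b.1) + 2 * n1 (unbox b.2)) %% 3)%N
  = \sum_(s < 3) F s *+ R1 s%:Z 3%:Z N.
Proof.
pose cls (b : ovbox N * ovbox N) := (n1 (unbox b.1) + 2 * n1 (unbox b.2))%N.
rewrite (partition_big (fun b => inord (cls b %% 3) : 'I_3) predT) //=.
apply: eq_bigr => s _; rewrite /R1 -sumr_const; apply: eq_big => b.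
  rewrite [in RHS]inE; congr (_ && _).
  rewrite -val_eqE /= inordK ?ltn_mod // /r1 /unbox_pair /= /cls.
  by rewrite eq_mod3_subn.
by case/andP=> _ /eqP <-; rewrite inordK ?ltn_mod.
Qed.

End PairSums.

(** * Weights at a cube root of unity *)

Section CubeRoot.

Local Open Scope ring_scope.

Lemma cube_root_factor (A : comNzRingType) (c y : A) :
  c ^+ 2 + c + 1 = 0 -> (1 + c * y) * (1 + c ^+ 2 * y) * (1 + y) = 1 + y ^+ 3.
Proof.
move=> c0.
transitivity (1 + y ^+ 3 + (c ^+ 2 + c + 1)
    * (y * (1 + y) + (c - 1) * y ^+ 2 * (1 + y))).
  by ring.
by rewrite c0 mul0r addr0.
Qed.

(** For z = w and z = 1/w = w^2 the products over the two components combine,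
    up to the factor prod (1 - X^k) / (1 + X^k), into a power series in X^3;
    by Gauss's identity that factor has no exponent congruent to 2 modulo 3. *)
Lemma coef_pair_eq0 (R : comNzRingType) (w : R) N :
  w ^+ 2 + w + 1 = 0 -> (N = 2 %[mod 3])%N ->
  (ovgf N w (bounded N) * ovgf N (w ^+ 2) (bounded N))`_N = 0.
Proof.
move=> w0 N2.
set A := ovgf N w _; set A' := ovgf N _ _.
have c0 : (w%:P) ^+ 2 + w%:P + 1 = 0 :> {poly R}.
  by rewrite -polyC_exp -polyCD -[1]/(1%:P) -polyCD w0.
have cubeD (y : {poly R}) :
    (1 + w%:P * y) * (1 + (w ^+ 2)%:P * y) * (1 + y) = 1 + y ^+ 3.
  by rewrite polyC_exp cube_root_factor.
have cubeB (y : {poly R}) :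
    (1 - w%:P * y) * (1 - (w ^+ 2)%:P * y) * (1 - y) = 1 - y ^+ 3.
  by have := cubeD (- y); rewrite !mulrN => ->; ring.
pose E3 := \prod_(j < N) (1 - 'X^(j.+1) ^+ 3 : {poly R}).
pose E3' := \prod_(j < N) (1 + 'X^(j.+1) ^+ 3 : {poly R}).
have pow3 j : in_powers 3 (('X^j) ^+ 3 : {poly R}).
  move=> i; rewrite -exprM coefXn; case: eqP => // ->.
  by rewrite dvdn_mull.
have pow1 : in_powers 3 (1 : {poly R}).
  by move=> i; rewrite coef1; case: i.
have E3p : in_powers 3 E3.
  by apply: in_powers_prod => j i i3; rewrite coefB pow1 // pow3 // subr0.
have E3'p : in_powers 3 E3'.
  by apply: in_powers_prod => j i i3; rewrite coefD pow1 // pow3 // addr0.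
have E30 : E3`_0 = 1.
  rewrite -horner_coef0 horner_prod big1 // => j _.
  by rewrite !hornerE /= !expr0n /= subr0.
set S : {poly R} := 1 + 2 * \sum_(1 <= j < N.+1) (-1) ^+ j * 'X^(j ^ 2).
suff: eqx N (E3 * (A * A')) (E3' * S).
  move=> eqAS; apply: (@missing_cancel _ N 3 2 E3) => // i iN i2.
  rewrite eqAS //; apply: (missingM E3'p) i2 => //.
  exact: missing_squares.
pose E := \prod_(j < N) (1 - 'X^(j.+1) : {poly R}).
pose E' := \prod_(j < N) (1 + 'X^(j.+1) : {poly R}).
apply: (@eqx_cancel _ _ E').
  rewrite -horner_coef0 horner_prod big1 // => j _.
  by rewrite !hornerE /= expr0n /= addr0.
rewrite [E' * (E3' * S)]mulrCA.
have GS : eqx N (E' * S) E by exact: gauss_eqx.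
apply: (eqx_trans _ (eqx_sym (eqxM (@eqx_refl _ _ E3') GS))).
have -> : E3 = \prod_(j < N) (1 - w%:P * 'X^(j.+1))
              * \prod_(j < N) (1 - (w ^+ 2)%:P * 'X^(j.+1)) * E.
  by rewrite -!big_split /=; apply: eq_bigr => j _; rewrite cubeB.
have -> : E3' = \prod_(j < N) (1 + w%:P * 'X^(j.+1))
              * \prod_(j < N) (1 + (w ^+ 2)%:P * 'X^(j.+1)) * E'.
  by rewrite -!big_split /=; apply: eq_bigr => j _; rewrite cubeD.
have := eqxM (eqxM (@ovgf_prod _ N w N) (@ovgf_prod _ N (w ^+ 2) N))
             (@eqx_refl _ _ (E * E')).
rewrite -/A -/A' => eqAA'; apply: (eqx_trans _ (eqx_trans eqAA' _)).
  by apply: eqx_eq; ring.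
by apply: eqx_eq; ring.
Qed.

Lemma cube_root_exists : {w : algC | w ^+ 2 + w + 1 = 0}.
Proof.
have [w w3] := C_prim_root_exists (isT : (0 < 3)%N); exists w.
have w1 : w - 1 != 0 by rewrite subr_eq0 -(prim_order_dvd w3 1).
apply: (mulfI w1); rewrite mulr0.
have -> : (w - 1) * (w ^+ 2 + w + 1) = w ^+ 3 - 1 by ring.
by rewrite (prim_expr_order w3) subrr.
Qed.

(** The quantity x^2 - xy + y^2 is the norm of x + yw, and it is a positive
    definite form in the integers x and y. *)
Lemma cube_root_free (w : algC) (x y : int) :
  w ^+ 2 + w + 1 = 0 -> x%:~R + y%:~R * w = 0 -> x = 0 /\ y = 0.
Proof.
move=> w0 xy0.
have : x%:~R ^+ 2 - x%:~R * y%:~R + y%:~R ^+ 2 = 0 :> algC.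
  transitivity ((x%:~R + y%:~R * w) * (x%:~R - y%:~R - y%:~R * w)
                + y%:~R ^+ 2 * (w ^+ 2 + w + 1)); first by ring.
  by rewrite xy0 w0 mul0r mulr0 addr0.
rewrite -!rmorphXn -rmorphM -rmorphB -rmorphD /= => /eqP.
by rewrite intr_eq0 => /eqP; rewrite !expr2; nia.
Qed.

End CubeRoot.

Theorem theorem3p1 (s n : nat) (hs : s <= 2) :
  ((R1 s%:Z 3%:Z (3 * n + 2)%N)%:R = (pp (3 * n + 2)%N)%:R / 3%:R :> rat)%R.
Proof.
set N := (3 * n + 2)%N.
have N2 : N = 2 %[mod 3] by rewrite /N mulnC modnMDl.
have [w w0] := cube_root_exists.
have w3 : (w ^+ 3 = 1)%R.
  apply/eqP; rewrite -subr_eq0; apply/eqP.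
  transitivity ((w - 1) * (w ^+ 2 + w + 1))%R; first by ring.
  by rewrite w0 mulr0.
have := sum_pairs_coefM w (w ^+ 2)%R N; rewrite (coef_pair_eq0 w0 N2).
have -> : (\sum_(b in overpartition_pairs N)
    w ^+ n1 (unbox b.1) * (w ^+ 2) ^+ n1 (unbox b.2) =
  \sum_(b in overpartition_pairs N)
    w ^+ ((n1 (unbox b.1) + 2 * n1 (unbox b.2)) %% 3))%R.
  by apply: eq_bigr => b _; rewrite expr_mod // exprD exprM.
rewrite (sum_pairs_R1 (fun i => w ^+ i)%R).
have := sum_pairs_R1 (fun=> 1%N) N; rewrite sum1_card -/(pp N).
rewrite !big_ord_recr !big_ord0 /= !add0r.
set a := R1 _ _ _; set b := R1 _ _ _; set c := R1 _ _ _ => ppE abc.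
have ab : (a%:Z - c%:Z)%R = 0 /\ (b%:Z - c%:Z)%R = 0.
  apply: (cube_root_free w0); rewrite -abc !rmorphB /= -!pmulrn.
  transitivity (1 *+ a + w *+ b + w ^+ 2 *+ c - c%:R * (w ^+ 2 + w + 1))%R.
    by ring.
  by rewrite w0 mulr0 subr0.
have -> : R1 s 3 N = a.
  have [ac bc] := ab.
  by move: hs; case: s => [|[|[|]]] // _; rewrite -/a -/b -/c; lia.
have -> : pp N = (a * 3)%N.
  by have [ac bc] := ab; move: ppE; rewrite !natn => ->; lia.
by rewrite natrM mulfK // pnatr_eq0.
Qed.
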